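(* Let $d\ge3$ and let $K:\mathbb{S}^{d-1}\times\mathbb{S}^{d-1}\to\mathbb{C}$ be a Hermitian, axially symmetric kernel of the form $$K(\xi,\zeta)=\sum_{\ell_1=-\infty}^{\infty}\ \sum_{\ell,\ell'\in\Lambda_{|\ell_1|}}c_{\ell_1}(\ell,\ell')\,Y_{\ell_1,\ell}(\xi)\,\overline{Y_{\ell_1,\ell'}(\zeta)},\qquad \xi,\zeta\in\mathbb{S}^{d-1},$$ with $$\sum_{\ell_1=-\infty}^{\infty}\ \sum_{\ell,\ell'\in\Lambda_{|\ell_1|}}|c_{\ell_1}(\ell,\ell')|\,\frac{\sqrt{N_{\ell_{d-1},d}N_{\ell'_{d-1},d}}}{\sigma_{d-1}}<\infty .$$ If $K$ is strictly positive definite on $\mathbb{S}^{d-1}$, then there are infinitely many $\ell_1\in\mathbb{Z}$ for which the mapping $c_{\ell_1}:\Lambda_{|\ell_1|}\times\Lambda_{|\ell_1|}\to\mathbb{C}$ is not identically zero.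
   Context: A Hermitian kernel $K:\Omega\times\Omega\to\mathbb{C}$ ($K(x,y)=\overline{K(y,x)}$) is called strictly positive definite on $\Omega$ if for every finite set $\Xi\subset\Omega$ of distinct points the matrix $(K(\xi,\zeta))_{\xi,\zeta\in\Xi}$ is positive definite on $\mathbb{C}^{|\Xi|}$. $\mathbb{S}^{d-1}$ is the unit sphere in $\mathbb{R}^d$ and $\sigma_{d-1}$ its surface area. $N_{0,d}=1$, $N_{j,d}=\frac{(2j+d-2)(j+d-3)!}{j!(d-2)!}$ for $j\ge1$. For $\ell_1\in\mathbb{Z}$, $\Lambda_{|\ell_1|}=\{\ell=(\ell_2,\ldots,\ell_{d-1})\in\mathbb{Z}^{d-2}:|\ell_1|\le\ell_2\le\cdots\le\ell_{d-1}\}$. In polar coordinates $\xi=(\theta_1,\ldots,\theta_{d-1})$, $\theta_1\in[0,2\pi)$, $\theta_j\in[0,\pi]$ for $j\ge2$ ($\xi_d=\cos\theta_{d-1}$, $\xi_{d-1}=\sin\theta_{d-1}\cos\theta_{d-2}$, ..., $\xi_2=\sin\theta_{d-1}\cdots\sin\theta_2\sin\theta_1$, $\xi_1=\sin\theta_{d-1}\cdots\sin\theta_2\cos\theta_1$), the functions $$Y_{\ell_1,\ell}(\xi)=Y_{\ell_1,\ldots,\ell_{d-1}}(\xi)=\frac{1}{\sqrt{2\pi}}e^{i\ell_1\theta_1}\prod_{j=2}^{d-1}{}_{j}\tilde P_{\ell_j}^{\ell_{j-1}}(\theta_j)$$ form an orthonormal basis of $L^2(\mathbb{S}^{d-1})$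 of spherical harmonics ($Y_{\ell_1,\ell}$ has degree $\ell_{d-1}$), where ${}_{j}\tilde P_{L}^{\ell}(\theta)={}_{j}c_L^{\ell}(\sin\theta)^{(2-j)/2}P_{L+(j-2)/2}^{-(\ell+(j-2)/2)}(\cos\theta)$ (extended continuously to $\theta\in\{0,\pi\}$), $P_\nu^\mu$ are the associated Legendre functions on $(-1,1)$ and ${}_{j}c_L^{\ell}=\left(\frac{2L+j-1}{2}\frac{(L+\ell+j-2)!}{(L-\ell)!}\right)^{1/2}$. Axially symmetric means invariant under simultaneous rotation $\theta_1\mapsto\theta_1+\alpha$ of both arguments for every $\alpha$ (every kernel of the displayed form has this property). *)

(* Defs.v *)
(* Mathematical Components world, with MathComp-Analysis. *)
From HB Require Import structures.
From mathcomp Require Import all_boot all_order all_algebra finmap.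
From mathcomp Require Import all_classical all_reals all_analysis.
From mathcomp Require Import complex.
From mathcomp.analysis.showcase Require summability.
Set Implicit Arguments.
Unset Strict Implicit.
Unset Printing Implicit Defensive.
Import Order.TTheory GRing.Theory Num.Theory numFieldNormedType.Exports.
Local Open Scope classical_set_scope.
Local Open Scope ring_scope.

Section Kernels.
Variables (R : realType) (T : Type).
Implicit Types (Omega : set T) (K : T -> T -> R[i]).

Definition hermitian_on Omega K :=
  forall x y, Omega x -> Omega y -> K x y = (K y x)^*.

(* In R[i], 0 < z means that z is real and positive. *)
Definition posdefmx n (A : 'M[R[i]]_n) :=
  forall v : 'cV[R[i]]_n, v != 0 ->
    0 < ((map_mx Num.conj v)^T *m A *m v) ord0 ord0.

Definition strictly_posdef_on Omega K :=
  forall (n : nat) (xi : 'I_n -> T),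
    injective xi -> (forall i, Omega (xi i)) ->
    posdefmx (\matrix_(i, j) K (xi i) (xi j)).

End Kernels.

(* Unconditional convergence to s of the sum of f over D: convergence along
   the finite sets of indices, directed by inclusion. *)
Definition has_sum (R : realType) (I : choiceType) (D : set I)
    (f : I -> R[i]) (s : R[i]) :=
  summability.partial_sum (fun i => if i \in D then f i else 0) A
    @[A --> summability.totally] --> (s : R[i]^o).

Section SpecialFunctions.
Variable R : realType.
Implicit Types (x mu nu theta : R) (j : nat) (L l : int).

(* 1 / Gamma, by Euler's limit formula; it vanishes at 0, -1, -2, ... *)
Definition rgamma x : R :=
  limn (fun n => (\prod_(k < n.+1) (x + k%:R)) / (n`!%:R * n%:R `^ x)).

Definition pochhammer x (k : nat) : R := \prod_(i < k) (x + i%:R).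

(* The associated Legendre function P_nu^mu on ]-1, 1[ (Ferrers function of the
   first kind):
     P_nu^mu(x) = ((1+x)/(1-x))^(mu/2) 2F1(-nu, nu+1; 1-mu; (1-x)/2) / Gamma(1-mu).
   1/Gamma(1-mu) is distributed over the series, as 1/Gamma(1-mu+k), so that
   the formula also covers the positive integers mu. *)
Definition legendreP nu mu x : R :=
  ((1 + x) / (1 - x)) `^ (mu / 2) *
  limn (series (fun k => pochhammer (- nu) k * pochhammer (nu + 1) k
     * rgamma (1 - mu + k%:R) / k`!%:R * ((1 - x) / 2) ^+ k)).

(* The factorials are only used with |l| <= L and 2 <= j, where the arguments
   of absz are nonnegative. *)
Definition normcst j L l : R :=
  Num.sqrt ((2 * L%:~R + j%:R - 1) / 2 *
            (`|(L + l + j%:Z - 2)%R|%N`!%:R / `|(L - l)%R|%N`!%:R)).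

Definition Ptilde_in j L l theta : R :=
  normcst j L l * sin theta `^ ((2 - j%:R) / 2)
  * legendreP (L%:~R + (j%:R - 2) / 2) (- (l%:~R + (j%:R - 2) / 2)) (cos theta).

Definition Ptilde j L l theta : R :=
  if (0 < theta) && (theta < pi) then Ptilde_in j L l theta
  else lim (Ptilde_in j L l t @[t --> within `]0, pi[ (nbhs theta)]).

End SpecialFunctions.

Section Sphere.
Variables (R : realType) (d : nat).

Definition sphere : set 'rV[R]_d :=
  [set x | \sum_(i < d) x ord0 i ^+ 2 = 1].

Definition sphere_area : R := 2 * pi `^ (d%:R / 2) * rgamma (d%:R / 2).

Definition harm_dim (j : nat) : R :=
  if j == 0%N then 1
  else ((2 * j + d - 2) * (j + d - 3)`!)%N%:R / (j`! * (d - 2)`!)%N%:R.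

(* Angles (theta_1, ..., theta_{d-1}), numbered from 1. *)
Definition angle (theta : d.-1.-tuple R) (j : nat) : R := nth 0 theta j.-1.

Definition polar_domain : set (d.-1.-tuple R) :=
  [set theta | 0 <= angle theta 1 < 2 * pi /\
     forall j, (2 <= j < d)%N -> 0 <= angle theta j <= pi].

(* The coordinate i : 'I_d is the (i+1)-st coordinate xi_{i+1}. *)
Definition polar (theta : d.-1.-tuple R) : 'rV[R]_d :=
  \row_(i < d) ((\prod_(maxn 2 i.+1 <= j < d) sin (angle theta j)) *
    (if val i == 0%N then cos (angle theta 1)
     else if val i == 1%N then sin (angle theta 1)
     else cos (angle theta i))).

(* Some polar coordinates of xi. They are unique unless sin(theta_j) = 0 for
   some j >= 2, and in that case Y below does not depend on the choice. *)
Definition polar_angles (xi : 'rV[R]_d) : d.-1.-tuple R :=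
  xget [tuple of nseq d.-1 0]
    [set theta | polar_domain theta /\ polar theta = xi].

Definition shift_angle1 (alpha : R) (theta : d.-1.-tuple R) :
    d.-1.-tuple R :=
  [tuple tnth theta i + (if val i == 0%N then alpha else 0) | i < d.-1].

Definition axially_symmetric (K : 'rV[R]_d -> 'rV[R]_d -> R[i]) :=
  forall (alpha : R) (theta theta' : d.-1.-tuple R),
    polar_domain theta -> polar_domain theta' ->
    K (polar (shift_angle1 alpha theta)) (polar (shift_angle1 alpha theta'))
    = K (polar theta) (polar theta').

(* The index ell = (ell_2, ..., ell_{d-1}). *)
Local Notation multi := ((d - 2).-tuple int).

Definition Lambda (m : int) : set multi := [set l : multi | path <=%R m l].

(* ell_j, for 1 <= j <= d-1. *)
Definition ell (l1 : int) (l : multi) (j : nat) : int :=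
  nth 0 (l1 :: l) j.-1.

Definition Y (l1 : int) (l : multi) (xi : 'rV[R]_d) : R[i] :=
  let theta := polar_angles xi in
  ((Num.sqrt (2 * pi))^-1)%:C%C
  * (cos (l1%:~R * angle theta 1) +i* sin (l1%:~R * angle theta 1))%C
  * (\prod_(2 <= j < d)
       Ptilde j (ell l1 l j) (ell l1 l j.-1) (angle theta j))%:C%C.

Definition indices : set (int * multi * multi) :=
  [set t | Lambda `|t.1.1| t.1.2 /\ Lambda `|t.1.1| t.2].

Definition degree (l1 : int) (l : multi) : nat := `|ell l1 l d.-1|%N.

Definition kernel_expansion (c : int -> multi -> multi -> R[i])
    (K : 'rV[R]_d -> 'rV[R]_d -> R[i]) :=
  forall xi zeta, sphere xi -> sphere zeta ->
    has_sum indices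
      (fun t => c t.1.1 t.1.2 t.2 * Y t.1.1 t.1.2 xi * (Y t.1.1 t.2 zeta)^*)
      (K xi zeta).

Definition coef_summable (c : int -> multi -> multi -> R[i]) :=
  (\esum_(t in indices)
     (complex.Re `|c t.1.1 t.1.2 t.2|
      * (Num.sqrt (harm_dim (degree t.1.1 t.1.2) * harm_dim (degree t.1.1 t.2))
         / sphere_area))%:E < +oo)%E.

End Sphere.

(* Main.v *)
(** If only finitely many frequencies l1 occur, take more points than
    frequencies on the great circle theta_2 = ... = theta_{d-1} = pi/2.  There
    every Y_{l1,l} is a constant multiple of exp(i l1 theta_1), so a nonzero
    vector v orthogonal to the finitely many vectors
    (exp(i l1 theta_1(xi_k)))_k kills every term of the expansion of the
    quadratic form of K at v, contradicting strict positive definiteness. *)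
Require Import Defs.
From mathcomp Require Import all_boot all_order all_algebra.
From mathcomp Require Import all_classical all_reals all_analysis.
From mathcomp Require Import complex.
From mathcomp.analysis.showcase Require Import summability.
From mathcomp Require Import ring lra zify.
Import Order.TTheory GRing.Theory Num.Theory numFieldNormedType.Exports.
Local Open Scope classical_set_scope.
Local Open Scope ring_scope.

Lemma has_sumMl (R : realType) (I : choiceType) (D : set I) (f : I -> R[i])
    (k s : R[i]) :
  has_sum D f s -> has_sum D (fun t => k * f t) (k * s).
Proof.
move=> fs; rewrite /has_sum.
have -> : partial_sum (fun t => if t \in D then k * f t else 0) =
    (fun A => (k : R[i]^o) *
       partial_sum (fun t => if t \in D then f t else 0) A).
  apply/funext => A; rewrite /partial_sum mulr_sumr.
  by apply: eq_bigr => t _; case: ifP; rewrite ?mulr0.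
exact: (@cvgMl_tmp R[i] _ _ totally_filter).
Qed.

(** Addition is continuous, so finite sums pass to the limit. With [has_sumMl] this expands a
    quadratic form of the kernel term by term. *)
Lemma has_sum_sum (R : realType) (I : choiceType) (D : set I) (J : Type)
    (r : seq J) (f : J -> I -> R[i]) (s : J -> R[i]) :
  (forall j, has_sum D (f j) (s j)) ->
  has_sum D (fun t => \sum_(j <- r) f j t) (\sum_(j <- r) s j).
Proof.
move=> fs; rewrite /has_sum.
have -> : partial_sum (fun t => if t \in D then \sum_(j <- r) f j t else 0) =
    (fun A => \sum_(j <- r)
       (partial_sum (fun t => if t \in D then f j t else 0) A : R[i]^o)).
  apply/funext => A; rewrite /partial_sum exchange_big /=.
  by apply: eq_bigr => t _; case: ifP => // _; rewrite big1.
apply: (@cvg_big R[i]^o J +%R 0 xpredT (@add_continuous R[i]^o) _ totally r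
  (fun j A => partial_sum (fun t => if t \in D then f j t else 0) A) s).
  exact: totally_filter.
by move=> j _; exact: fs.
Qed.

(** All partial sums vanish, and limits in the Hausdorff space [R[i]] are unique. *)
Lemma has_sum_eq0 (R : realType) (I : choiceType) (D : set I) (f : I -> R[i])
    (s : R[i]) :
  (forall t, D t -> f t = 0) -> has_sum D f s -> s = 0.
Proof.
move=> f0; rewrite /has_sum.
have -> : partial_sum (fun t => if t \in D then f t else 0) =
    (fun=> (0 : R[i]^o)).
  apply/funext => A; rewrite /partial_sum big1// => t _.
  by case: ifPn => // /set_mem/f0.
move=> h; have FF := @totally_filter I.
apply: (@cvg_unique R[i]^o (@norm_hausdorff _ _) _
  (fmap_proper_filter _ FF) _ _ h).
exact: cvg_cst.
Qed.

Lemma wide_system_ker (F : fieldType) m n (A : 'M[F]_(m, n)) :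
  (n < m)%N -> exists2 v : 'rV[F]_m, v != 0 & v *m A = 0.
Proof.
move=> nm; have /rowV0Pn[v /submxP[w ->] v0] : kermx A != 0.
  rewrite kermx_eq0 -row_leq_rank -ltnNge.
  exact: leq_ltn_trans (rank_leq_col A) nm.
by exists (w *m kermx A); rewrite // -mulmxA mulmx_ker mulmx0.
Qed.

Section Equator.
Variables (R : realType) (d : nat).
Hypothesis hd : (3 <= d)%N.

Lemma cos_eq0_itv (x : R) : 0 <= x <= pi -> cos x = 0 -> x = pi / 2.
Proof.
move=> xpi cx; have := @pi_gt0 R => pi0.
by apply: cos_inj; rewrite ?in_itv/= ?cx ?cos_pihalf//; lra.
Qed.

Definition equator_angles (a : R) : d.-1.-tuple R :=
  [tuple if val i == 0%N then a else pi / 2 | i < d.-1].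

Lemma angle_equator a j : (1 <= j < d)%N ->
  angle (equator_angles a) j = if j == 1%N then a else pi / 2.
Proof.
move=> jd; rewrite /angle; have jd1 : (j.-1 < d.-1)%N by lia.
rewrite -(tnth_nth 0 _ (Ordinal jd1)) tnth_mktuple /=.
by case: j jd {jd1} => // -[].
Qed.

Lemma polar_domain_equator a : 0 <= a < 2 * pi ->
  @polar_domain R d (equator_angles a).
Proof.
move=> a2pi; split=> [|j jd]; first by rewrite angle_equator//; lia.
rewrite angle_equator; last by lia.
have := @pi_gt0 R; by case: eqP => [|_ pi0]; [lia | lra].
Qed.

Lemma polar_equator a (i : 'I_d) : @polar R d (equator_angles a) ord0 i =
  if val i == 0%N then cos a else if val i == 1%N then sin a else 0.
Proof.
rewrite mxE big_nat big1 => [|j jd].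
  rewrite mul1r angle_equator /=; last by lia.
  case: eqP => // i0; case: eqP => // i1.
  rewrite angle_equator; last by have := ltn_ord i; lia.
  by rewrite (negbTE (introN eqP i1)) cos_pihalf.
rewrite angle_equator; last by lia.
by case: eqP => [j1|_]; [lia | rewrite sin_pihalf].
Qed.

Lemma sphere_equator a : @sphere R d (@polar R d (equator_angles a)).
Proof.
rewrite /sphere /=.
under eq_bigr do rewrite polar_equator.
case: d hd => [//|[//|n]] _.
rewrite !big_ord_recl /= big1 ?addr0 ?cos2Dsin2// => i _.
by rewrite expr0n.
Qed.

(** On the half circle the first coordinate, a cosine, already separates points. *)
Lemma polar_equator_inj a b : 0 <= a <= pi -> 0 <= b <= pi ->
  @polar R d (equator_angles a) = @polar R d (equator_angles b) -> a = b.
Proof.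
move=> a_pi b_pi /matrixP/(_ ord0 (Ordinal (ltnW (ltnW hd)))).
by rewrite !polar_equator /= => /cos_inj; apply; rewrite in_itv.
Qed.

Lemma polar_anglesP theta : @polar_domain R d theta ->
  @polar_domain R d (@polar_angles R d (@polar R d theta)) /\
  @polar R d (@polar_angles R d (@polar R d theta)) = @polar R d theta.
Proof.
move=> dom; apply: (@xgetPex _ _
  [set t | @polar_domain R d t /\ @polar R d t = @polar R d theta]).
by exists theta.
Qed.

(** Downward induction from j = d-1: once all later angles are pi/2, their sines are 1 and the
    coordinate of index j is just cos(theta_j). Hence whichever angles [polar_angles] picks for an
    equator point, those from theta_2 on are pi/2. *)
Lemma angle_pihalf (theta : d.-1.-tuple R) : @polar_domain R d theta ->
  (forall i : 'I_d, (2 <= i)%N -> @polar R d theta ord0 i = 0) ->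
  forall j, (2 <= j < d)%N -> angle theta j = pi / 2.
Proof.
move=> [_ dom] theta0 j.
have [k] := ubnP (d - j); elim: k j => // k IHk j jk jd.
apply: cos_eq0_itv; first exact: dom.
have jltd : (j < d)%N by lia.
have /= := theta0 (Ordinal jltd); rewrite mxE /=.
rewrite big_nat big1 => [|i id].
  rewrite mul1r; case: eqP => [|_]; first by lia.
  by case: eqP => [|_]; [lia | apply; lia].
by rewrite IHk ?sin_pihalf//; lia.
Qed.

Lemma angle_polar_angles_equator a j : 0 <= a < 2 * pi -> (2 <= j < d)%N ->
  angle (@polar_angles R d (@polar R d (equator_angles a))) j = pi / 2.
Proof.
move=> /polar_domain_equator/polar_anglesP[dom polarE].
apply: angle_pihalf => // i; rewrite polarE polar_equator.
by case: i => -[|[|i]].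
Qed.

End Equator.

Definition phase (R : realType) (m : int) (x : R) : R[i] :=
  (cos (m%:~R * x) +i* sin (m%:~R * x))%C.

(** [C] collects the factors in theta_2, ..., theta_{d-1}, all taken at pi/2, and so is the same for
    every [a]. The phase is taken at the angle chosen by [polar_angles], which avoids identifying
    that angle with [a]. *)
Lemma Y_equator (R : realType) (d : nat) (l1 : int) (l : (d - 2).-tuple int) :
  (3 <= d)%N -> exists C : R[i], forall a : R, 0 <= a < 2 * pi ->
    let xi := @polar R d (equator_angles R d a) in
    Y l1 l xi = C * phase R l1 (angle (@polar_angles R d xi) 1).
Proof.
move=> hd.
exists (((Num.sqrt (2 * pi))^-1)%:C%C * (\prod_(2 <= j < d)
  Ptilde j (ell l1 l j) (ell l1 l j.-1) (pi / 2))%:C%C) => a a2pi /=.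
rewrite /Y [LHS]mulrAC; congr (_ * _%:C%C * _).
by apply: eq_big_nat => j jd; rewrite angle_polar_angles_equator.
Qed.

Theorem lemma9 (R : realType) (d : nat) (hd : (3 <= d)%N)
  (K : 'rV[R]_d -> 'rV[R]_d -> R[i])
  (c : int -> (d - 2).-tuple int -> (d - 2).-tuple int -> R[i])
  (hK : hermitian_on (@sphere R d) K)
  (hsym : axially_symmetric K)
  (hexp : kernel_expansion c K)
  (hsum : coef_summable c)
  (hspd : strictly_posdef_on (@sphere R d) K) :
  infinite_set [set l1 : int | exists l l' : (d - 2).-tuple int,
    [/\ Lambda `|l1| l, Lambda `|l1| l' & c l1 l l' != 0]].
Proof.
move=> /finite_seqP[s sE].
(* Distinct angles in [0, pi], one more than the frequencies listed in [s]. *)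
pose a (k : 'I_(size s).+1) : R := pi / (k.+1)%:R.
have aP k : 0 <= a k <= pi.
  rewrite divr_ge0 ?pi_ge0//= ler_pdivrMr ?ltr0n//.
  by rewrite ler_peMr ?pi_ge0// ler1n.
have a2pi k : 0 <= a k < 2 * pi by have := aP k; have := @pi_gt0 R; lra.
pose xi k : 'rV[R]_d := @polar R d (equator_angles R d (a k)).
have xi_inj : injective xi.
  move=> k k' /(polar_equator_inj _ _ hd _ _ (aP k) (aP k')).
  move=> /(mulfI (lt0r_neq0 (pi_gt0 R)))/invr_inj/eqP.
  by rewrite eqr_nat eqSS => /eqP/val_inj.
(* Rows are points and columns are frequencies, so the rows are linearly dependent. *)
have [v v0 vM] := wide_system_ker _ _ _
  (\matrix_(k < (size s).+1, j < size s)
     phase R s`_j (angle (polar_angles (xi k)) 1)) (ltnSn _).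
(* A nonzero coefficient puts its frequency in [s], hence among the columns that [v] annihilates. *)
have vY t : c t.1.1 t.1.2 t.2 != 0 -> indices t ->
    \sum_k v ord0 k * Y t.1.1 t.1.2 (xi k) = 0.
  case: t => [[l1 l] l'] /= c0 [/= Ll Ll'].
  have : [set` s] l1 by rewrite -sE; exists l, l'.
  move=> /= l1s; have [C YE] := @Y_equator R d l1 l hd.
  under eq_bigr do rewrite YE// mulrCA.
  rewrite -mulr_sumr.
  have ks : (index l1 s < size s)%N by rewrite index_mem.
  move/matrixP/(_ ord0 (Ordinal ks)): vM; rewrite !mxE.
  under eq_bigr do rewrite mxE /= nth_index//.
  by move=> ->; rewrite mulr0.
have Kv : \sum_k \sum_k' v ord0 k * ((v ord0 k')^* * K (xi k) (xi k')) = 0.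
  have hs := fun k k' => hexp (xi k) (xi k') (sphere_equator _ _ hd _)
    (sphere_equator _ _ hd _).
  have := has_sum_sum _ _ _ _ (index_enum _) _ _ (fun k =>
    has_sum_sum _ _ _ _ (index_enum _) _ _ (fun k' =>
    has_sumMl _ _ _ _ (v ord0 k) _
      (has_sumMl _ _ _ _ (v ord0 k')^* _ (hs k k')))).
  apply: has_sum_eq0 => t It.
  have [c0|c0] := eqVneq (c t.1.1 t.1.2 t.2) 0.
    rewrite big1 // => k _; rewrite big1// => k' _.
    by rewrite c0 !(mul0r, mulr0).
  (* For fixed [k'], summing over [k] first isolates the factor that [vY] makes zero. *)
  rewrite exchange_big big1// => k' _.
  transitivity (\sum_k (v ord0 k * Y t.1.1 t.1.2 (xi k)) *
      ((v ord0 k')^* * (c t.1.1 t.1.2 t.2 * (Y t.1.1 t.2 (xi k'))^*))).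
    apply: eq_bigr => k _; ring.
  by rewrite -mulr_suml vY// mul0r.
(* [posdefmx] conjugates its left vector, so [w] is the conjugate of [v]: the form at [w] then has
   the weights of [Kv]. *)
pose w : 'cV[R[i]]_(size s).+1 := (map_mx Num.conj v)^T.
have w0 : w != 0.
  apply: contra v0 => /eqP w0; apply/eqP/rowP => k; rewrite mxE.
  move/matrixP/(_ k ord0): w0; rewrite !mxE => /eqP.
  by rewrite fmorph_eq0 => /eqP.
have := hspd _ xi xi_inj (fun k => sphere_equator _ _ hd (a k)) w w0.
rewrite -mulmxA mxE.
under eq_bigr => k _.
  rewrite !mxE conjCK mulr_sumr.
  under eq_bigr do rewrite !mxE [K _ _ * _]mulrC.
  over.
by rewrite Kv ltxx.
Qed.
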